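(* Let $n\in\mathbb{N}$ and $\alpha=(a_1,\dots,a_n)\in[n]^n$. Then $\alpha\in\mathrm{PF}_n(1)$ if and only if both of the following hold: (1) there exist $j\in[n-1]$ and distinct $k,k'\in[n]$ such that $a_k=a_{k'}=j$ and $a_i\neq j$ for every index $i\neq k,k'$; and (2) $\{a_i : i\in[n],\ i\neq k,k'\}=[n]\setminus\{j,j+1\}$.
   Context: $[m]=\{1,\dots,m\}$. Parking functions: $n$ cars numbered $1,\dots,n$ enter in order a one-way street with spots $1,\dots,n$. Given a preference vector $\alpha=(a_1,\dots,a_n)\in[n]^n$, car $i$ drives to spot $a_i$ and parks there if it is free; otherwise it parks in the first free spot after $a_i$ (if none exists, it fails to park). $\alpha$ is a parking function of length $n$ if all cars park. If car $i$ parks in spot $p_i$, its displacement is $p_i-a_i$, and the displacement of $\alpha$ is the sum of the displacements of all cars. $\mathrm{PF}_n(1)$ is the set of parking functions of length $n$ with displacement exactly $1$. *)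

(* Defs.v *)
From mathcomp Require Import all_boot.

Set Implicit Arguments.
Unset Strict Implicit.
Unset Printing Implicit Defensive.

(* Cars and spots 1, ..., n are both encoded by 'I_n, with shift by one: the
   ordinal of value m stands for the car (or spot) m.+1. Displacements, being
   differences of spots, are unaffected by the shift. *)

(* enum 'I_n is increasing, so the head of the filtered list is a itself when a
   is free, and otherwise the first free spot after a. *)
Definition first_free n (occ : {set 'I_n}) (a : 'I_n) : option 'I_n :=
  ohead [seq s : 'I_n <- enum 'I_n | (a <= s) && (s \notin occ)].

(* A car that fails to park leaves the street and occupies no spot. *)
Fixpoint park n (occ : {set 'I_n}) (prefs : seq 'I_n) : seq (option 'I_n) :=
  if prefs is a :: prefs' then
    let p := first_free occ a in
    p :: park (if p is Some s then s |: occ else occ) prefs'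
  else [::].

Definition parked_spot n (alpha : n.-tuple 'I_n) (i : 'I_n) : option 'I_n :=
  nth None (park set0 alpha) i.

Definition parking_function n (alpha : n.-tuple 'I_n) : bool :=
  [forall i : 'I_n, isSome (parked_spot alpha i)].

(* The value 0 for a car that fails to park is a convention which plays no role
   for parking functions; a parked car has a_i <= p_i, so the subtraction is
   never truncated. *)
Definition car_displacement n (alpha : n.-tuple 'I_n) (i : 'I_n) : nat :=
  if parked_spot alpha i is Some p then p - tnth alpha i else 0.

Definition displacement n (alpha : n.-tuple 'I_n) : nat :=
  \sum_(i < n) car_displacement alpha i.

Definition PF n (d : nat) : {set n.-tuple 'I_n} :=
  [set alpha | parking_function alpha && (displacement alpha == d)].

(* Main.v *)
(** Let [p] be the outcome of the parking process. The values [p i] are distinct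
    and [a_i <= p i], so total displacement 1 means that [p] is a permutation
    which differs from the preferences at exactly one car [k'], where
    [p k' = a_k' + 1]; the car [k] parked in spot [a_k'] is then the other car
    with that preference. Conversely, of two cars with preference [j] the later
    one is pushed to [j + 1], and the permutation so obtained satisfies the
    recursion which characterises the outcome. *)
Require Import Defs.
From mathcomp Require Import all_boot.

Set Implicit Arguments.
Unset Strict Implicit.
Unset Printing Implicit Defensive.

Lemma first_freeP n (occ : {set 'I_n}) (a s : 'I_n) :
  first_free occ a = Some s <->
  [/\ a <= s, s \notin occ & forall t : 'I_n, a <= t < s -> t \in occ].
Proof.
rewrite /first_free; set P := (fun s : 'I_n => (a <= s) && (s \notin occ)).
have lt_sorted : sorted (relpre val ltn) [seq s <- enum 'I_n | P s].
  apply: sorted_filter; first by move=> x y z /=; apply: ltn_trans.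
  by rewrite -sorted_map val_enum_ord iota_ltn_sorted.
have min_head u l : [seq s <- enum 'I_n | P s] = u :: l ->
    P u /\ forall t, P t -> u <= t.
  move=> def_ul; rewrite def_ul in lt_sorted.
  have memP t : (t \in u :: l) = P t by rewrite -def_ul mem_filter mem_enum andbT.
  split=> [|t]; first by rewrite -memP mem_head.
  rewrite -memP inE => /predU1P[-> //|tl].
  have lt_trans : transitive (relpre (@nat_of_ord n) ltn).
    by move=> x y z /=; apply: ltn_trans.
  by have /allP/(_ _ tl)/ltnW := order_path_min lt_trans lt_sorted.
case def_ul : [seq s <- enum 'I_n | P s] => [|u l] /=.
  split=> // -[le_as free_s _].
  have : s \in [seq s <- enum 'I_n | P s].
    by rewrite mem_filter mem_enum /P le_as free_s.
  by rewrite def_ul.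
have [/andP[le_au free_u] min_u] := min_head _ _ def_ul.
split=> [[<-]|[le_as free_s min_s]].
  split=> // t /andP[le_at lt_tu]; apply: contraLR lt_tu => free_t.
  by rewrite -leqNgt min_u // /P le_at.
congr Some; apply/val_inj/eqP; rewrite eqn_leq min_u /P ?le_as //=.
by rewrite leqNgt; apply: contra free_u => lt_us; apply: min_s; rewrite le_au.
Qed.

Lemma size_park n (occ : {set 'I_n}) prefs : size (park occ prefs) = size prefs.
Proof. by elim: prefs occ => //= a prefs IH occ; rewrite IH. Qed.

(** Unrolls the accumulator: the street met by car [i] holds [occ] and the spots taken by earlier
    cars. A failed car contributes [None] to the prefix, hence no spot. *)
Lemma nth_park n (occ : {set 'I_n}) prefs a0 i : i < size prefs ->
  nth None (park occ prefs) i =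
  first_free (occ :|: [set s | Some s \in take i (park occ prefs)])
             (nth a0 prefs i).
Proof.
elim: prefs occ i => //= a prefs IH occ [_|i lt_i] /=.
  by congr first_free; apply/setP=> s; rewrite !inE orbF.
rewrite IH //; congr first_free; apply/setP=> s.
case: (first_free occ a) => [u|]; rewrite !inE //.
by rewrite -orbA orbCA.
Qed.

(** The recursion for the outcome, free of lists: the right-hand side consults [parked_spot] only at
    cars before [i]. *)
Lemma parked_spotP n (alpha : n.-tuple 'I_n) (i s : 'I_n) :
  parked_spot alpha i = Some s <->
  [/\ tnth alpha i <= s,
      forall l : 'I_n, l < i -> parked_spot alpha l <> Some s
    & forall t : 'I_n, tnth alpha i <= t < s ->
        exists2 l : 'I_n, l < i & parked_spot alpha l = Some t].
Proof.
have memP (t : 'I_n) :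
    reflect (exists2 l : 'I_n, l < i & parked_spot alpha l = Some t)
            (Some t \in take i (park set0 alpha)).
  have size_take_i : size (take i (park set0 alpha)) = i.
    by rewrite size_takel // size_park size_tuple ltnW.
  apply: (iffP (nthP None)) => [[l]|[l lt_li def_l]]; last first.
    by exists (val l); rewrite ?size_take_i // nth_take.
  rewrite size_take_i => lt_li; rewrite nth_take // => def_l.
  by exists (Ordinal (ltn_trans lt_li (ltn_ord i))).
rewrite {1}/parked_spot (nth_park _ (tnth_default alpha i)) ?size_tuple //.
rewrite -tnth_nth; apply: iff_trans (first_freeP _ _ _) _.
split=> -[le_as free_s min_s]; split=> //.
- by move=> l lt_li def_l; case/negP: free_s; rewrite !inE; apply/memP; exists l.
- by move=> t /min_s; rewrite !inE => /memP.
- by rewrite !inE; apply/memP=> -[l /free_s].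
- by move=> t /min_s lt_t; rewrite !inE; apply/memP.
Qed.

Lemma parked_spot_inj n (alpha : n.-tuple 'I_n) (i l s : 'I_n) :
  parked_spot alpha i = Some s -> parked_spot alpha l = Some s -> i = l.
Proof.
move=> def_i def_l; apply: val_inj.
have [_ free_i _] := (parked_spotP _ _ _).1 def_i.
have [_ free_l _] := (parked_spotP _ _ _).1 def_l.
by case: (ltngtP i l) => // [/free_l|/free_i].
Qed.

(** Strong induction on the car: once [p] agrees with the outcome on earlier cars, the recursion
    determines the next spot. Injectivity of [p] says that this spot is still free. *)
Lemma parked_spot_unique n (alpha : n.-tuple 'I_n) (p : 'I_n -> 'I_n) :
    injective p -> (forall i, tnth alpha i <= p i) ->
    (forall i t : 'I_n, tnth alpha i <= t < p i ->
       exists2 l : 'I_n, l < i & p l = t) ->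
  forall i, parked_spot alpha i = Some (p i).
Proof.
move=> p_inj le_ap p_min i; have [m] := ubnP i.
elim: m i => // m IH i le_im.
have IHi (l : 'I_n) : l < i -> parked_spot alpha l = Some (p l).
  by move=> lt_li; apply: IH; apply: leq_trans lt_li _.
apply/parked_spotP; split=> // [l lt_li|t /p_min[l lt_li <-]].
  by rewrite IHi // => -[/p_inj eq_li]; rewrite eq_li ltnn in lt_li.
by exists l; rewrite ?IHi.
Qed.

Lemma PF1_doubled_preference n (alpha : n.-tuple 'I_n) : alpha \in PF n 1 ->
  exists (j : 'I_n) (hj : j.+1 < n) (k k' : 'I_n),
    [/\ k <> k', tnth alpha k = j, tnth alpha k' = j
      & forall i : 'I_n, i <> k -> i <> k' -> tnth alpha i <> j] /\
    [set tnth alpha i | i : 'I_n & (i != k) && (i != k')] =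
      [set: 'I_n] :\: [set j; Ordinal hj].
Proof.
rewrite inE => /andP[/forallP parked].
(* The default [i] is never returned, since every car parks. *)
pose p i := odflt i (parked_spot alpha i).
have pE i : parked_spot alpha i = Some (p i).
  by rewrite /p; case: parked_spot (parked i).
have p_inj : injective p.
  by move=> i l eq_p; apply: (@parked_spot_inj _ alpha _ _ (p i)); rewrite pE ?eq_p.
have le_ap i : tnth alpha i <= p i by have [] := (parked_spotP _ _ _).1 (pE i).
have [q pK qK] := injF_bij p_inj.
(* A sum of naturals equal to 1 has one term 1, at [k'], and all others 0. *)
case/sum_nat_eq1=> k' []; rewrite /car_displacement pE => _ disp1 disp0.
have def_pk' : p k' = (tnth alpha k').+1 :> nat.
  by rewrite -(subnK (le_ap k')) disp1.
have a_eq_p i : i != k' -> tnth alpha i = p i.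
  move=> ne_ik'; have /eqP := disp0 i ne_ik' isT.
  rewrite pE subn_eq0 => le_pa.
  by apply/val_inj/eqP; rewrite eqn_leq le_ap.
have hj : (tnth alpha k').+1 < n by rewrite -def_pk'.
set j := tnth alpha k'; set k := q j.
have p_k : p k = j by rewrite /k qK.
have p_k' : p k' = Ordinal hj by apply: val_inj.
(* Otherwise [p k'] would be both [j] and [j.+1]. *)
have ne_kk' : k != k'.
  apply/eqP=> eq_kk'; have /eqP := def_pk'.
  by rewrite -{1}eq_kk' p_k ltn_eqF.
exists j, hj, k, k'; split.
  split=> //; [exact/eqP | by rewrite a_eq_p|].
  move=> i ne_ik /eqP ne_ik'; rewrite a_eq_p // -p_k.
  by move/p_inj.
(* With the two removed spots written as [p k] and [p k'], bijectivity of [p] turns removing spots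
   into removing cars. *)
apply/setP=> s; rewrite !inE andbT -p_k' -p_k; apply/imsetP/idP.
  case=> i; rewrite inE => /andP[ne_ik ne_ik'] ->.
  by rewrite a_eq_p // !(inj_eq p_inj) negb_or ne_ik.
rewrite -[s]qK !(inj_eq p_inj) negb_or => ne_q.
by exists (q s); rewrite ?inE // a_eq_p //; case/andP: ne_q.
Qed.

(** The order [k < k'] decides which car is displaced: [k] takes [j] first, and [k'] moves on to
    [j.+1]. *)
Lemma doubled_preference_PF1 n (alpha : n.-tuple 'I_n)
    (j : 'I_n) (hj : j.+1 < n) (k k' : 'I_n) :
    k < k' -> tnth alpha k = j -> tnth alpha k' = j ->
    [set tnth alpha i | i : 'I_n & (i != k) && (i != k')] =
      [set: 'I_n] :\: [set j; Ordinal hj] ->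
  alpha \in PF n 1.
Proof.
move=> lt_kk' a_k a_k' im_a.
have ne_kk' : k != k' by apply: contraTneq lt_kk' => ->; rewrite ltnn.
pose p i := if i == k' then Ordinal hj else tnth alpha i.
have p_k' : p k' = Ordinal hj by rewrite /p eqxx.
have p_k : p k = j by rewrite /p (negPf ne_kk').
have p_inj : injective p.
  (* On a finite set onto implies injective: [k] covers [j], [k'] covers [j.+1], and the image
     hypothesis covers the rest. *)
  suff p_onto : p @: setT = setT.
    have /imset_injP p_injT : #|p @: setT| == #|[set: 'I_n]| by rewrite p_onto.
    by move=> x y; apply: p_injT; rewrite inE.
  apply/setP=> s; rewrite inE; apply/imsetP.
  have [->|ne_sj] := eqVneq s j; first by exists k.
  have [->|ne_sj1] := eqVneq s (Ordinal hj); first by exists k'.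
  have : s \in [set: 'I_n] :\: [set j; Ordinal hj].
    by rewrite !inE negb_or ne_sj ne_sj1.
  rewrite -im_a => /imsetP[i]; rewrite inE => /andP[_ ne_ik'] ->.
  by exists i; rewrite // /p (negPf ne_ik').
have pE : forall i, parked_spot alpha i = Some (p i).
  apply: parked_spot_unique => // [i|i t]; rewrite /p; case: eqVneq => [->|_] //=.
  - by rewrite a_k'.
  (* The only spot that [k'] passes over is [j], held by the earlier car [k]. *)
  - rewrite a_k' ltnS -eqn_leq => /eqP/val_inj <-.
    by exists k.
  - by move=> /andP[le_at /(leq_ltn_trans le_at)]; rewrite ltnn.
rewrite inE; apply/andP; split; first by apply/forallP=> i; rewrite pE.
rewrite /displacement (bigD1 k') //= big1 => [|i ne_ik'].
  by rewrite /car_displacement pE p_k' a_k' /= subSnn.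
by rewrite /car_displacement pE /p (negPf ne_ik') subnn.
Qed.

Theorem theorem2 (n : nat) (alpha : n.-tuple 'I_n) :
  alpha \in PF n 1 <->
  exists (j : 'I_n) (hj : j.+1 < n) (k k' : 'I_n),
    [/\ k <> k', tnth alpha k = j, tnth alpha k' = j
      & forall i : 'I_n, i <> k -> i <> k' -> tnth alpha i <> j] /\
    [set tnth alpha i | i : 'I_n & (i != k) && (i != k')] =
      [set: 'I_n] :\: [set j; Ordinal hj].
Proof.
split; first exact: PF1_doubled_preference.
case=> j [hj [k [k' [[ne_kk' a_k a_k' _] im_a]]]].
case: (ltngtP k k') => [lt_kk'|lt_k'k|/val_inj //].
  exact: doubled_preference_PF1 lt_kk' a_k a_k' im_a.
(* The condition is symmetric in the two cars, so their names may be exchanged. *)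
apply: (@doubled_preference_PF1 _ _ _ hj _ _ lt_k'k) => //.
rewrite -im_a; apply/setP=> s.
by apply/imsetP/imsetP=> -[i ne_i ->]; exists i; rewrite // !inE andbC in ne_i *.
Qed.
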